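(* Assume that $X_N$ and $X_M\subset X_N$ are antipodally symmetric and that $\operatorname{rank}(V_{N,r})=R$, $\operatorname{rank}(V_{M,r})=M$. For any function $f:\mathbb{S}^2\to\mathbb{R}$, $$\hat p_r[f^\star]=(\hat p_r[f])^\star,$$ where for a function $g:\mathbb{S}^2\to\mathbb{R}$ we set $g^\star(\boldsymbol{x}):=g(-\boldsymbol{x})$, $\boldsymbol{x}\in\mathbb{S}^2$. Thus, the interpolation--regression operator on the sphere is equivariant under the antipodal map.
   Context: $\Pi_r(\mathbb{S}^2)$ is the space of spherical polynomials of degree at most $r$ on the unit sphere $\mathbb{S}^2\subset\mathbb{R}^3$, of dimension $R=(r+1)^2$. $X_N=\{\boldsymbol{x}_1,\dots,\boldsymbol{x}_N\}\subset\mathbb{S}^2$ is a set of $N$ distinct sampling nodes and $X_M=\{\boldsymbol{x}_1',\dots,\boldsymbol{x}_M'\}\subset X_N$ a subset of $M$ distinct interpolation nodes. Conventions: $N=(n+1)^2$, $M=(m+1)^2$, with integers $0\le m<r<n$. A set $X\subset\mathbb{S}^2$ is antipodally symmetric if $\boldsymbol{x}\in X$ implies $-\boldsymbol{x}\in X$. For a fixed basis $\{b_1,\dots,b_R\}$ of $\Pi_r(\mathbb{S}^2)$, $V_{N,r}=[b_j(\boldsymbol{x}_i)]\in\mathbb{R}^{N\times R}$ and $V_{M,r}=[b_j(\boldsymbol{x}_i')]\in\mathbb{R}^{M\times R}$. For $f:\mathbb{S}^2\to\mathbb{R}$, the interpolation--regression approximant $\hat p_r[f]$ is the (under the rank assumptions,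 unique) minimizer of $\sum_{i=1}^N|p(\boldsymbol{x}_i)-f(\boldsymbol{x}_i)|^2$ over all $p\in\Pi_r(\mathbb{S}^2)$ subject to $p(\boldsymbol{x}_j')=f(\boldsymbol{x}_j')$, $j=1,\dots,M$. *)

(* Defs.v *)
From HB Require Import structures.
From mathcomp Require Import all_boot all_order all_algebra.
From mathcomp Require Import boolp classical_sets functions reals.
From mathcomp Require Import mpoly.
Set Implicit Arguments.
Unset Strict Implicit.
Unset Printing Implicit Defensive.
Import Order.TTheory GRing.Theory Num.Theory.
Local Open Scope ring_scope.
Local Open Scope classical_set_scope.

Definition sphere (R : realType) := {v : 'rV[R]_3 | \sum_i v 0 i ^+ 2 == 1}.

Lemma antipode_subproof (R : realType) (x : sphere R) :
  \sum_i (- val x) 0 i ^+ 2 == 1.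
Proof.
apply/eqP; rewrite -[RHS](eqP (valP x)); apply: eq_bigr => i _.
by rewrite mxE sqrrN.
Qed.

Definition antipode (R : realType) (x : sphere R) : sphere R :=
  exist _ (- val x) (antipode_subproof x).

Definition star (R : realType) (g : sphere R -> R) : sphere R -> R :=
  fun x => g (antipode x).

Definition antipodally_symmetric (R : realType) (X : set (sphere R)) :=
  forall x, X x -> X (antipode x).

(* Restrictions to the sphere of the polynomials in three variables of total
   degree at most r; msize is the total degree plus one. *)
Definition sph_poly (R : realType) (r : nat) : set (sphere R -> R) :=
  [set g | exists2 p : {mpoly R[3]}, (msize p <= r.+1)%N &
             forall x : sphere R, g x = p.@[val x 0]].
Arguments sph_poly : clear implicits.

Definition is_basis (R : realType) (D : nat) (b : 'I_D -> sphere R -> R)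
    (V : set (sphere R -> R)) :=
  [/\ forall j, V (b j),
      forall c : 'I_D -> R,
        (forall x, \sum_j c j * b j x = 0) -> forall j, c j = 0
    & forall g, V g ->
        exists c : 'I_D -> R, forall x, g x = \sum_j c j * b j x].

Definition vandermonde (R : realType) (K D : nat) (b : 'I_D -> sphere R -> R)
    (x : 'I_K -> sphere R) : 'M[R]_(K, D) :=
  \matrix_(i, j) b j (x i).

Definition sq_error (R : realType) (N : nat) (x : 'I_N -> sphere R)
    (f p : sphere R -> R) : R :=
  \sum_i `|p (x i) - f (x i)| ^+ 2.

Definition interpolants (R : realType) (r M : nat) (x' : 'I_M -> sphere R)
    (f : sphere R -> R) : set (sphere R -> R) :=
  [set p | sph_poly R r p /\ forall j, p (x' j) = f (x' j)].

Definition is_interp_regr (R : realType) (r N M : nat) (x : 'I_N -> sphere R)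
    (x' : 'I_M -> sphere R) (f p : sphere R -> R) :=
  interpolants r x' f p /\
  forall q, interpolants r x' f q -> sq_error x f p <= sq_error x f q.

(* The zero function is only a default value: under the rank assumptions the
   minimizer exists and is unique (interp_regr_ex_unique). *)
Definition interp_regr (R : realType) (r N M : nat) (x : 'I_N -> sphere R)
    (x' : 'I_M -> sphere R) (f : sphere R -> R) : sphere R -> R :=
  xget (fun=> 0) [set p | is_interp_regr r x x' f p].

Lemma sqnorm_eq0 (R : realType) (n : nat) (u : 'cV[R]_n) :
  u^T *m u = 0 -> u = 0.
Proof.
move=> /matrixP/(_ 0 0); rewrite !mxE => /eqP.
rewrite psumr_eq0 => [|i _]; last by rewrite mxE -expr2 sqr_ge0.
move=> /allP u0; apply/matrixP => i j; rewrite ord1 mxE.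
have := u0 i (mem_index_enum i).
by rewrite mxE mulf_eq0 orbb => /eqP.
Qed.

Lemma unitmx_ker (R : realType) (n : nat) (A : 'M[R]_n) :
  (forall u : 'cV_n, A *m u = 0 -> u = 0) -> A \in unitmx.
Proof.
move=> A0; rewrite -unitmx_tr -row_free_unit -kermx_eq0; apply/eqP/row_matrixP => i.
rewrite row0 -[row i _]trmxK (A0 (row i (kermx A^T))^T) ?trmx0 //.
apply: trmx_inj; rewrite trmx_mul trmxK trmx0; apply/sub_kermxP.
exact: row_sub.
Qed.

Lemma full_rank_inj (R : realType) (n m : nat) (A : 'M[R]_(n, m)) (u : 'cV_m) :
  \rank A = m -> A *m u = 0 -> u = 0.
Proof.
move=> rA Au; have : row_free A^T by rewrite /row_free mxrank_tr rA.
move/row_freeP => [B AB]; rewrite -[u]mul1mx -trmx1 -AB trmx_mul trmxK.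
by rewrite -mulmxA Au mulmx0.
Qed.

Lemma constrained_least_squares (R : realType) (N M D : nat)
    (A : 'M[R]_(N, D)) (B : 'M[R]_(M, D)) (a : 'cV[R]_N) (d : 'cV[R]_M) :
  \rank A = D -> \rank B = M ->
  exists2 c : 'cV[R]_D, B *m c = d &
    forall q, B *m q = d ->
      (A *m q - a)^T *m (A *m q - a) =
      (A *m c - a)^T *m (A *m c - a) + (A *m (q - c))^T *m (A *m (q - c)).
Proof.
move=> rA rB; pose G := A^T *m A.
have G0 (u : 'cV_D) : u^T *m (G *m u) = 0 -> u = 0.
  move=> h; apply: (full_rank_inj rA); apply: sqnorm_eq0.
  by rewrite trmx_mul -mulmxA -h /G !mulmxA.
have Gu : G \in unitmx by apply: unitmx_ker => u h; apply: G0; rewrite h mulmx0.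
have Gt : (invmx G)^T = invmx G by rewrite trmx_inv /G trmx_mul trmxK.
pose S := B *m invmx G *m B^T.
have Su : S \in unitmx.
  apply: unitmx_ker => u h; apply: (@full_rank_inj _ _ _ B^T).
    by rewrite mxrank_tr.
  suff w0 : invmx G *m (B^T *m u) = 0.
    by rewrite -[B^T *m u](mulKVmx Gu) w0 mulmx0.
  apply: G0; rewrite mulKVmx // !trmx_mul trmxK Gt.
  by rewrite -[RHS](mulmx0 _ u^T) -h /S !mulmxA.
pose l := invmx S *m (d - B *m invmx G *m (A^T *m a)).
pose c := invmx G *m (A^T *m a + B^T *m l).
have Bc : B *m c = d.
  rewrite /c mulmxA mulmxDr [_ *m (B^T *m l)]mulmxA -/S /l mulKVmx //.
  by rewrite addrC subrK.
exists c => // q Bq; set e := q - c.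
have Be : B *m e = 0 by rewrite mulmxBr Bq Bc subrr.
have eA : (A *m e)^T *m (A *m c - a) = 0.
  rewrite trmx_mul -mulmxA mulmxBr [A^T *m (A *m c)]mulmxA -/G /c mulKVmx //.
  by rewrite addrC addKr mulmxA -trmx_mul Be trmx0 mul0mx.
have Ae : (A *m c - a)^T *m (A *m e) = 0.
  by apply: trmx_inj; rewrite trmx_mul trmxK eA trmx0.
have -> : A *m q - a = (A *m c - a) + A *m e.
  by rewrite /e mulmxBr [RHS]addrC addrA subrK.
move: (A *m c - a) (A *m e) eA Ae => u v eA Ae.
by rewrite [(_ + _)^T]raddfD /= mulmxDl !mulmxDr eA Ae addr0 add0r.
Qed.

Lemma sph_poly_comb (R : realType) (r D : nat) (b : 'I_D -> sphere R -> R)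
    (c : 'I_D -> R) :
  (forall j, sph_poly R r (b j)) ->
  sph_poly R r (fun x => \sum_j c j * b j x).
Proof.
move=> hb.
have /choice [p hp] : forall j, exists p : {mpoly R[3]}, (msize p <= r.+1)%N /\
    forall x : sphere R, b j x = p.@[val x 0].
  by move=> j; have [p ? ?] := hb j; exists p.
exists (\sum_j c j *: p j).
  apply: (leq_trans (msize_sum _ _ _)); apply/bigmax_leqP => j _.
  exact: leq_trans (msizeZ_le _ _) (hp j).1.
move=> x; rewrite raddf_sum /=; apply: eq_bigr => j _.
by rewrite mevalZ (hp j).2.
Qed.

Lemma interp_regr_ex_unique (R : realType) (r N M D : nat)
    (b : 'I_D -> sphere R -> R) (x : 'I_N -> sphere R) (x' : 'I_M -> sphere R)
    (f : sphere R -> R) :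
  is_basis b (sph_poly R r) ->
  \rank (vandermonde b x) = D -> \rank (vandermonde b x') = M ->
  exists! p, is_interp_regr r x x' f p.
Proof.
move=> [bV _ bS] rA rB.
set A := vandermonde b x in rA; set B := vandermonde b x' in rB.
pose a : 'cV[R]_N := \col_i f (x i); pose d : 'cV[R]_M := \col_i f (x' i).
pose F (c : 'cV[R]_D) : sphere R -> R := fun z => \sum_j c j 0 * b j z.
have FE K (y : 'I_K -> sphere R) c i : (vandermonde b y *m c) i 0 = F c (y i).
  by rewrite !mxE; apply: eq_bigr => j _; rewrite mxE mulrC.
have FS g : sph_poly R r g -> exists c, g = F c.
  move=> /bS [c hc]; exists (\col_j c j); apply/funext => z; rewrite hc.
  by apply: eq_bigr => j _; rewrite mxE.
have FV c : sph_poly R r (F c) by exact: sph_poly_comb.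
have FB c : (forall j, F c (x' j) = f (x' j)) <-> B *m c = d.
  split=> [h|h j]; last by rewrite -FE -/B h mxE.
  by apply/matrixP => i j; rewrite ord1 FE h mxE.
have err c : sq_error x f (F c) = ((A *m c - a)^T *m (A *m c - a)) 0 0.
  rewrite [RHS]mxE; apply: eq_bigr => i _.
  rewrite real_normK ?num_real // expr2.
  have -> : (A *m c - a)^T 0 i = (A *m c - a) i 0 by rewrite mxE.
  have -> : (A *m c - a) i 0 = (A *m c) i 0 - a i 0 by rewrite !mxE.
  by rewrite FE mxE.
have [c Bc Hc] := constrained_least_squares a d rA rB.
have sq_ge0 (u : 'cV[R]_N) : 0 <= (u^T *m u) 0 0.
  by rewrite mxE sumr_ge0 // => i _; rewrite mxE -expr2 sqr_ge0.
exists (F c); split.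
  split=> [|q [qV]]; first by split=> //; apply/FB.
  have [e ->] := FS q qV; move=> /FB /Hc He.
  by rewrite !err He [leRHS]mxE lerDl sq_ge0.
move=> q [[qV qf] qmin]; have [e qE] := FS q qV; subst q.
move/FB/Hc: qf => He; rewrite [F c](_ : _ = F e) //.
have := qmin (F c); rewrite !err He => /(_ _).
have Fc : interpolants r x' f (F c) by split=> //; apply/FB.
move=> /(_ Fc); rewrite [leLHS]mxE gerDl => le0.
have s0 : (A *m (e - c))^T *m (A *m (e - c)) = 0.
  by apply/matrixP => i j; rewrite !ord1 [RHS]mxE; apply/eqP; rewrite eq_le le0 sq_ge0.
have /eqP := full_rank_inj rA (sqnorm_eq0 s0).
by rewrite subr_eq0 => /eqP ->.
Qed.

(* Main.v *)
(** The antipodal map acts on the spherical polynomials of degree at most r and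
    permutes both node sets, so g |-> g^* carries the constrained least-squares
    problem for f onto the one for f^*; uniqueness of the minimizer concludes. *)

Require Import Defs.
From mathcomp Require Import all_boot all_order all_algebra.
From mathcomp Require Import boolp classical_sets functions reals.
From mathcomp Require Import mpoly.
Set Implicit Arguments.
Unset Strict Implicit.
Unset Printing Implicit Defensive.
Import Order.TTheory GRing.Theory Num.Theory.
Local Open Scope ring_scope.
Local Open Scope classical_set_scope.

Lemma antipodeK (R : realType) : involutive (@antipode R).
Proof. by move=> z; apply: val_inj; rewrite /= opprK. Qed.

Lemma starK (R : realType) : involutive (@star R).
Proof. by move=> g; apply/funext => z; rewrite /star antipodeK. Qed.

(** Negating the argument multiplies ['X_[k]] by [(-1) ^+ mdeg k], so no degree increases. *)
Lemma sph_poly_star (R : realType) (r : nat) (g : sphere R -> R) :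
  sph_poly R r g -> sph_poly R r (star g).
Proof.
move=> [p psz gE].
(* The witness is p(-X), expanded over the support of [p] so that [msize p] bounds each term. *)
exists (\sum_(k <- msupp p) ((-1) ^+ mdeg k * p@_k) *: 'X_[k]).
  apply: leq_trans (msize_sum _ _ _) _; apply/bigmax_leqP_seq => k kp _.
  apply: leq_trans (msizeZ_le _ _) _; rewrite msizeX.
  exact: leq_trans (msize_mdeg_lt kp) psz.
move=> z; rewrite /star gE mevalE raddf_sum /=; apply: eq_bigr => k _.
rewrite mevalZ mevalX mulrAC mulrC; congr (_ * _).
rewrite mdegE -prodrXr -big_split /=; apply: eq_bigr => i _.
by rewrite mxE -exprMn mulN1r.
Qed.

Lemma interpolants_star (R : realType) (r M : nat) (x' : 'I_M -> sphere R)
    (f p : sphere R -> R) :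
  antipodally_symmetric (range x') ->
  interpolants r x' f p -> interpolants r x' (star f) (star p).
Proof.
move=> symX [pV pf]; split; first exact: sph_poly_star.
(* The condition for [star f] at [x' j] is the one for [f] at the antipodal node [x' k]. *)
move=> j; have [|k _ xk] := symX (x' j); first by exists j.
by rewrite /star -xk pf.
Qed.

(** The antipodal map only permutes the summands: it induces a map [s] on indices, which injectivity
    of [x] makes an involution. *)
Lemma sq_error_star (R : realType) (N : nat) (x : 'I_N -> sphere R)
    (f p : sphere R -> R) :
  injective x -> antipodally_symmetric (range x) ->
  sq_error x (star f) (star p) = sq_error x f p.
Proof.
move=> xinj symX.
have /choice [s sE] : forall i, exists k, x k = antipode (x i).
  by move=> i; have [|k _ xk] := symX (x i); [exists i | exists k].
have sK : involutive s by move=> i; apply: xinj; rewrite !sE antipodeK.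
rewrite /sq_error [RHS](reindex_inj (inv_inj sK)) /=.
by apply: eq_bigr => i _; rewrite /star sE.
Qed.

Lemma is_interp_regr_star (R : realType) (r N M : nat) (x : 'I_N -> sphere R)
    (x' : 'I_M -> sphere R) (f p : sphere R -> R) :
  injective x -> antipodally_symmetric (range x) ->
  antipodally_symmetric (range x') ->
  is_interp_regr r x x' f p -> is_interp_regr r x x' (star f) (star p).
Proof.
move=> xinj symX symX' [pI pmin]; split; first exact: interpolants_star.
(* A competitor [q] for [star f] gives the competitor [star q] for [f], with the same error. *)
move=> q /(interpolants_star symX'); rewrite starK => /pmin.
by rewrite -(sq_error_star f p) // -(sq_error_star f (star q)) // starK.
Qed.

Theorem theorem5 (R : realType) (m r n : nat) (hmr : (m < r)%N) (hrn : (r < n)%N)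
    (b : 'I_(r.+1 ^ 2) -> sphere R -> R) (hb : is_basis b (sph_poly R r))
    (x : 'I_(n.+1 ^ 2) -> sphere R) (hx : injective x)
    (x' : 'I_(m.+1 ^ 2) -> sphere R) (hx' : injective x')
    (hsub : range x' `<=` range x)
    (hXN : antipodally_symmetric (range x))
    (hXM : antipodally_symmetric (range x'))
    (hrankN : \rank (vandermonde b x) = (r.+1 ^ 2)%N)
    (hrankM : \rank (vandermonde b x') = (m.+1 ^ 2)%N)
    (f : sphere R -> R) :
  interp_regr r x x' (star f) = star (interp_regr r x x' f).
Proof.
(* Existence of a minimizer rules out the default value of [xget]. *)
have regrP g : is_interp_regr r x x' g (interp_regr r x x' g).
  have [p [pP _]] := interp_regr_ex_unique g hb hrankN hrankM.
  exact: (xgetPex _ (ex_intro _ p pP)).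
have [p [_ p_uniq]] := interp_regr_ex_unique (star f) hb hrankN hrankM.
(* Both sides are minimizers for [star f], hence both equal [p]. *)
rewrite -(p_uniq _ (regrP (star f))); apply: p_uniq.
exact: is_interp_regr_star (regrP f).
Qed.
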